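(* Let $S$ be a $\Gamma$-semiring which has a left unity and a right unity, and let $R$ be its right operator semiring. For a fuzzy subset $\sigma$ of $S$ let $\sigma^{*'}$ be the fuzzy subset of $R$ defined by $\sigma^{*'}(\sum_i[\alpha_i,x_i])=\inf_{a\in S}\sigma(\sum_i a\alpha_i x_i)$. Then the map $\sigma\mapsto\sigma^{*'}$ is an inclusion preserving bijection from the lattice of all fuzzy left ideals of $S$ to the lattice of all fuzzy left ideals of $R$. Likewise, the map $\sigma\mapsto\sigma^{*'}$ is an inclusion preserving bijection from the lattice of all fuzzy ideals of $S$ to the lattice of all fuzzy ideals of $R$.
   Context: $\Gamma$-semiring: $S$ and $\Gamma$ are (nonempty) additive commutative semigroups with a map $S\times\Gamma\times S\to S$, $(a,\alpha,b)\mapsto a\alpha b$, such that $a\alpha(b+c)=a\alpha b+a\alpha c$, $(a+b)\alpha c=a\alpha c+b\alpha c$, $a(\alpha+\beta)c=a\alpha c+a\beta c$, $a\alpha(b\beta c)=(a\alpha b)\beta c$ for all $a,b,c\in S$, $\alpha,\beta\in\Gamma$. No zero elements are assumed. Right operator semiring $R$: let $G$ be the free additive commutative semigroup generated by $\Gamma\times S$ (finite nonempty formal sums). Identify $\sum_i(\alpha_i,x_i)$ with $\sum_j(\beta_j,y_j)$ iff $\sum_i a\alpha_i x_i=\sum_j a\beta_j y_j$ for all $a\in S$; this is a congruence on $G$. The class of $\sum_i(\alpha_i,x_i)$ is written $\sum_i[\alpha_i,x_i]$. $R$ is the quotient, with the induced addition and the multiplication $(\sum_i[\alpha_i,x_i])(\sum_j[\beta_j,y_j])=\sum_{i,j}[\alpha_i,x_i\beta_j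 y_j]$; it is a semiring. Unities: a right unity of $S$ is a finite sum $\sum_j[\gamma_j,f_j]\in R$ with $\sum_j a\gamma_j f_j=a$ for all $a\in S$. A left unity of $S$ is given by finitely many $e_i\in S$, $\delta_i\in\Gamma$ with $\sum_i e_i\delta_i a=a$ for all $a\in S$. A fuzzy subset of a set $X$ is a function $X\to[0,1]$; inclusion of fuzzy subsets is the pointwise order ($\sigma\le\tau$ iff $\sigma(x)\le\tau(x)$ for all $x$), and the lattices of fuzzy (left) ideals are ordered by it. Inclusion preserving means $\sigma\le\tau$ implies $\sigma^{*'}\le\tau^{*'}$. A fuzzy subset $\mu$ of $S$ is a fuzzy left (respectively right) ideal of $S$ if for all $a,b\in S$, $\alpha\in\Gamma$: $\mu(a+b)\ge\min(\mu(a),\mu(b))$ and $\mu(a\alpha b)\ge\mu(b)$ (respectively $\mu(a\alpha b)\ge\mu(a)$). A fuzzy subset $\mu$ of $R$ is a fuzzy left (respectively right) ideal of $R$ if for all $p,q\in R$: $\mu(p+q)\ge\min(\mu(p),\mu(q))$ and $\mu(pq)\ge\mu(q)$ (respectively $\mu(pq)\ge\mu(p)$). A fuzzy ideal (of $S$ or of $R$) is a fuzzy subset that is both a fuzzy left ideal and a fuzzy right ideal. *)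

(* Defs.v *)
From HB Require Import structures.
From mathcomp Require Import all_boot all_order all_algebra generic_quotient.
From mathcomp Require Import boolp classical_sets functions reals.

Set Implicit Arguments.
Unset Strict Implicit.
Unset Printing Implicit Defensive.

Import Order.TTheory GRing.Theory Num.Theory.

Local Open Scope quotient_scope.
Local Open Scope classical_set_scope.
Local Open Scope ring_scope.

(* There is no zero: a formal sum is nonempty, and is represented by its first
   term together with the list of the others, up to permutation. *)
Section FreeSemigroup.
Variable T : choiceType.
Implicit Types s t u : T * seq T.

Definition termsof s : seq T := s.1 :: s.2.

Definition eq_terms s t := perm_eq (termsof s) (termsof t).

Fact eq_terms_refl : reflexive eq_terms.
Proof. by move=> s; apply: perm_refl. Qed.

Fact eq_terms_sym : symmetric eq_terms.
Proof. by move=> s t; apply: perm_sym. Qed.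

Fact eq_terms_trans : transitive eq_terms.
Proof. by move=> t s u; apply: perm_trans. Qed.

Canonical eq_terms_equiv := EquivRel eq_terms
  eq_terms_refl eq_terms_sym eq_terms_trans.

Definition freeSg := {eq_quot eq_terms}.

HB.instance Definition _ := Choice.on freeSg.
HB.instance Definition _ := EqQuotient.on freeSg.

Definition fgen (x : T) : freeSg := \pi_freeSg (x, [::]).

Definition addterms s t : T * seq T := (s.1, s.2 ++ termsof t).

Definition fadd : freeSg -> freeSg -> freeSg := lift_op2 freeSg addterms.

Lemma pi_fadd : {morph \pi : s t / addterms s t >-> fadd s t}.
Proof.
move=> s t; unlock fadd; apply/eqmodP; rewrite /= /eq_terms /termsof /=.
have es : eq_terms (repr (\pi_freeSg s)) s by apply/eqmodP; rewrite reprK.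
have et : eq_terms (repr (\pi_freeSg t)) t by apply/eqmodP; rewrite reprK.
by rewrite -!cat_cons perm_sym; apply: perm_cat.
Qed.

Canonical pi_fadd_morph := PiMorph2 pi_fadd.

Fact faddC : commutative fadd.
Proof.
elim/quotW=> s; elim/quotW=> t; rewrite !piE; apply/eqmodP.
by rewrite /= /eq_terms /termsof /= -!cat_cons perm_catC.
Qed.

Fact faddA : associative fadd.
Proof.
elim/quotW=> s; elim/quotW=> t; elim/quotW=> u; rewrite !piE; apply/eqmodP.
by rewrite /= /eq_terms /termsof /= -catA.
Qed.

HB.instance Definition _ := Algebra.isAddSemigroup.Build freeSg faddC faddA.

End FreeSemigroup.

Section FiniteSums.
Variables (T : choiceType) (V : addSemigroupType).
Implicit Types (F : T -> V) (g h : freeSg T) (s t : T * seq T).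

Definition sumterms F s : V := foldl (fun v x => v + F x) (F s.1) s.2.

(* [nsum F g] is the sum of [F x] over the terms x of the nonempty formal sum
   g; it is the unique additive extension of F (lemmas nsum_gen, nsumD). *)
Definition nsum F g : V := sumterms F (repr g).

Let foldl_addl F v w r :
  foldl (fun v x => v + F x) (v + w) r = v + foldl (fun v x => v + F x) w r.
Proof. by elim: r w => //= x r IH w; rewrite -Algebra.addrA IH. Qed.

Lemma sumterms_perm F s t : eq_terms s t -> sumterms F s = sumterms F t.
Proof.
pose f (o : option V) x := Some (if o is Some v then v + F x else F x).
have fS v r : foldl f (Some v) r = Some (foldl (fun v x => v + F x) v r).
  by elim: r v => //= x r IH v; rewrite IH.
have foldE s' : foldl f None (termsof s') = Some (sumterms F s').
  by rewrite /= fS.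
have fAC o x y : f (f o x) y = f (f o y) x.
  by rewrite /f; case: o => [v|]; [rewrite Algebra.addrAC | rewrite Algebra.addrC].
have fperm r1 r2 : perm_eq r1 r2 -> forall o, foldl f o r1 = foldl f o r2.
  elim: r1 r2 => [|x r1 IH] r2; first by rewrite perm_sym => /perm_nilP->.
  move=> pr o; have xr2 : x \in r2 by rewrite -(perm_mem pr) mem_head.
  have /IH{}IH : perm_eq r1 (rem x r2).
    by rewrite -(perm_cons x); apply: perm_trans pr (perm_to_rem xr2).
  rewrite /= IH; elim: r2 xr2 o {pr IH} => //= y r2 IH2.
  rewrite inE; case: eqVneq => [->|] //= yx xr2 o; rewrite fAC; exact: IH2.
by move=> /fperm/(_ None); rewrite !foldE => -[].
Qed.

Lemma nsum_pi F s : nsum F (\pi s) = sumterms F s.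
Proof. by apply: sumterms_perm; apply/eqmodP; rewrite reprK. Qed.

Lemma nsum_gen F x : nsum F (fgen x) = F x.
Proof. exact: nsum_pi. Qed.

Lemma nsumD F : {morph nsum F : g h / g + h}.
Proof.
elim/quotW=> s; elim/quotW=> t.
have -> : \pi_(freeSg T) s + \pi_(freeSg T) t = \pi_(freeSg T) (addterms s t) by rewrite pi_fadd.
by rewrite !nsum_pi /sumterms foldl_cat /= foldl_addl.
Qed.

Lemma freeSg_ind (P : freeSg T -> Prop) :
  (forall x, P (fgen x)) -> (forall g h, P g -> P h -> P (g + h)) ->
  forall g, P g.
Proof.
move=> Pgen PD; elim/quotW=> -[x r]; elim/last_ind: r => [|r y IH]; first exact: Pgen.
have -> : \pi_(freeSg T) (x, rcons r y) = \pi_(freeSg T) (x, r) + fgen y.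
  by rewrite /fgen -[RHS]pi_fadd /addterms /= cats1.
exact: PD.
Qed.

End FiniteSums.

HB.mixin Record isSemiringNoZero S
    of Algebra.AddSemigroup S & Semigroup S := {
  mulsDl : forall a b c : S, ((a + b)%R * c)%g = ((a * c)%g + (b * c)%g)%R;
  mulsDr : forall a b c : S, (a * (b + c)%R)%g = ((a * b)%g + (a * c)%g)%R
}.

#[short(type="semiringNoZeroType")]
HB.structure Definition SemiringNoZero :=
  {S of isSemiringNoZero S & Algebra.AddSemigroup S & Semigroup S}.

HB.mixin Record isGammaSemiring (Gamma : addSemigroupType) S
    of Algebra.AddSemigroup S := {
  gmul : S -> Gamma -> S -> S;
  inhabited_gamma : inhabited Gamma;
  inhabited_gsemiring : inhabited S;
  gmulDr : forall a x b c, gmul a x (b + c) = gmul a x b + gmul a x c;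
  gmulDl : forall a b x c, gmul (a + b) x c = gmul a x c + gmul b x c;
  gmulDm : forall a x y c, gmul a (x + y) c = gmul a x c + gmul a y c;
  gmulA : forall a x b y c, gmul a x (gmul b y c) = gmul (gmul a x b) y c
}.

#[short(type="gammaSemiringType")]
HB.structure Definition GammaSemiring (Gamma : addSemigroupType) :=
  {S of isGammaSemiring Gamma S & Algebra.AddSemigroup S}.

Section RightOperatorSemiring.
Variables (Gamma : addSemigroupType) (S : gammaSemiringType Gamma).

Local Notation formal := (freeSg (Gamma * S)%type).
Implicit Types (a b : S) (g h k : formal).

(* a . sum_i (alpha_i, x_i) = sum_i a alpha_i x_i *)
Definition formal_act a g : S := nsum (fun u => gmul a u.1 u.2) g.

Definition eq_op_formal g h : bool := `[< forall a, formal_act a g = formal_act a h >].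

Fact eq_op_formal_refl : reflexive eq_op_formal.
Proof. by move=> g; apply/asboolP. Qed.

Fact eq_op_formal_sym : symmetric eq_op_formal.
Proof. by move=> g h; apply/asboolP/asboolP=> E a; rewrite E. Qed.

Fact eq_op_formal_trans : transitive eq_op_formal.
Proof.
by move=> h g k /asboolP E1 /asboolP E2; apply/asboolP=> a; rewrite E1.
Qed.

Canonical eq_op_formal_equiv := EquivRel eq_op_formal
  eq_op_formal_refl eq_op_formal_sym eq_op_formal_trans.

Definition rightOp := {eq_quot eq_op_formal}.

HB.instance Definition _ := Choice.on rightOp.
HB.instance Definition _ := EqQuotient.on rightOp.

(* (sum_i (alpha_i, x_i)) (sum_j (beta_j, y_j))
     = sum_(i, j) (alpha_i, x_i beta_j y_j) *)
Definition formal_mul g h : formal :=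
  nsum (fun u => nsum (fun v => fgen (u.1, gmul u.2 v.1 v.2)) h) g.

Definition rightOp_add : rightOp -> rightOp -> rightOp :=
  lift_op2 rightOp (fun g h : formal => g + h).
Definition rightOp_mul : rightOp -> rightOp -> rightOp :=
  lift_op2 rightOp formal_mul.

(* The action of R on S: ract a (sum_i [alpha_i, x_i]) = sum_i a alpha_i x_i,
   see ract_pi. *)
Definition ract a (p : rightOp) : S := formal_act a (repr p).

Lemma ract_pi a g : ract a (\pi g) = formal_act a g.
Proof.
have /asboolP : eq_op_formal (repr (\pi_rightOp g)) g.
  by apply/eqmodP; rewrite reprK.
exact.
Qed.

Lemma ract_inj (p q : rightOp) : (forall a, ract a p = ract a q) -> p = q.
Proof.
move=> E; rewrite -[p]reprK -[q]reprK; apply/eqmodP; apply/asboolP => a.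
exact: E.
Qed.

Lemma formal_actD a g h : formal_act a (g + h) = formal_act a g + formal_act a h.
Proof. exact: nsumD. Qed.

Lemma formal_actDl a b g : formal_act (a + b) g = formal_act a g + formal_act b g.
Proof.
elim/freeSg_ind: g => [x|g h IHg IHh]; first by rewrite /formal_act !nsum_gen gmulDl.
by rewrite !formal_actD IHg IHh Algebra.addrACA.
Qed.

Lemma formal_act_gmul a x b g : formal_act (gmul a x b) g = gmul a x (formal_act b g).
Proof.
elim/freeSg_ind: g => [u|g h IHg IHh]; first by rewrite /formal_act !nsum_gen gmulA.
by rewrite !formal_actD IHg IHh gmulDr.
Qed.

Lemma formal_mulDl g h k :
  formal_mul (g + h) k = formal_mul g k + formal_mul h k.
Proof. exact: nsumD. Qed.

Lemma formal_act_mul a g h : formal_act a (formal_mul g h) = formal_act (formal_act a g) h.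
Proof.
elim/freeSg_ind: g => [u|g g' IHg IHg']; last first.
  by rewrite formal_mulDl !formal_actD IHg IHg' formal_actDl.
rewrite /formal_mul nsum_gen [formal_act a (fgen u)]nsum_gen formal_act_gmul.
elim/freeSg_ind: h => [v|h h' IHh IHh']; first by rewrite /formal_act !nsum_gen.
by rewrite nsumD !formal_actD IHh IHh' gmulDr.
Qed.

Lemma ractD a (p q : rightOp) : ract a (rightOp_add p q) = ract a p + ract a q.
Proof. by unlock rightOp_add; rewrite ract_pi formal_actD. Qed.

Lemma ractM a (p q : rightOp) : ract a (rightOp_mul p q) = ract (ract a p) q.
Proof. by unlock rightOp_mul; rewrite ract_pi formal_act_mul. Qed.

Lemma ractDl a b (p : rightOp) : ract (a + b) p = ract a p + ract b p.
Proof. exact: formal_actDl. Qed.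

Lemma pi_rightOp_add :
  {morph \pi_rightOp : g h / g + h >-> rightOp_add g h}.
Proof. by move=> g h; apply: ract_inj => a; rewrite ractD !ract_pi formal_actD. Qed.

Lemma pi_rightOp_mul :
  {morph \pi_rightOp : g h / formal_mul g h >-> rightOp_mul g h}.
Proof. by move=> g h; apply: ract_inj => a; rewrite ractM !ract_pi formal_act_mul. Qed.

Fact rightOp_addC : commutative rightOp_add.
Proof. by move=> p q; apply: ract_inj => a; rewrite !ractD Algebra.addrC. Qed.

Fact rightOp_addA : associative rightOp_add.
Proof. by move=> p q r; apply: ract_inj => a; rewrite !ractD Algebra.addrA. Qed.

Fact rightOp_mulA : associative rightOp_mul.
Proof. by move=> p q r; apply: ract_inj => a; rewrite !ractM. Qed.

HB.instance Definition _ :=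
  Algebra.isAddSemigroup.Build rightOp rightOp_addC rightOp_addA.
HB.instance Definition _ := isSemigroup.Build rightOp rightOp_mulA.

Fact rightOp_mulDl (p q r : rightOp) :
  ((p + q)%R * r)%g = ((p * r)%g + (q * r)%g)%R.
Proof. by apply: ract_inj => a; rewrite ractM !ractD !ractM ractDl. Qed.

Fact rightOp_mulDr (p q r : rightOp) :
  (p * (q + r)%R)%g = ((p * q)%g + (p * r)%g)%R.
Proof. by apply: ract_inj => a; rewrite ractM !ractD !ractM. Qed.

HB.instance Definition _ :=
  isSemiringNoZero.Build rightOp rightOp_mulDl rightOp_mulDr.

End RightOperatorSemiring.

Arguments rightOp {Gamma} S.

Section Unities.
Variables (Gamma : addSemigroupType) (S : gammaSemiringType Gamma).

Definition has_right_unity :=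
  exists p : rightOp S, forall a : S, ract a p = a.

(* The formal sum e stands for the finite nonempty family of the
   (e_i, delta_i). *)
Definition has_left_unity :=
  exists e : freeSg (S * Gamma)%type,
    forall a : S, nsum (fun u => gmul u.1 u.2 a) e = a.

End Unities.

Arguments has_right_unity {Gamma} S.
Arguments has_left_unity {Gamma} S.

(* A fuzzy subset is a function X -> K with values in [0, 1]. Inclusion of
   fuzzy subsets is the pointwise order that boolp puts on function types. *)
Definition is_fuzzy (K : realType) (X : Type) (mu : X -> K) : Prop :=
  forall x, 0 <= mu x <= 1.

Section FuzzyIdealsGammaSemiring.
Variables (K : realType) (Gamma : addSemigroupType).
Variable S : gammaSemiringType Gamma.
Implicit Types mu : S -> K.

Definition gfuzzy_left_ideal : set (S -> K) := [set mu |
  [/\ is_fuzzy mu,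
      forall a b, Num.min (mu a) (mu b) <= mu (a + b)
    & forall a x b, mu b <= mu (gmul a x b)]].

Definition gfuzzy_right_ideal : set (S -> K) := [set mu |
  [/\ is_fuzzy mu,
      forall a b, Num.min (mu a) (mu b) <= mu (a + b)
    & forall a x b, mu a <= mu (gmul a x b)]].

Definition gfuzzy_ideal := gfuzzy_left_ideal `&` gfuzzy_right_ideal.

End FuzzyIdealsGammaSemiring.

Section FuzzyIdealsSemiring.
Variables (K : realType) (R : semiringNoZeroType).
Implicit Types mu : R -> K.

Definition fuzzy_left_ideal : set (R -> K) := [set mu |
  [/\ is_fuzzy mu,
      forall p q, Num.min (mu p) (mu q) <= mu (p + q)
    & forall p q, mu q <= mu (p * q)%g]].

Definition fuzzy_right_ideal : set (R -> K) := [set mu |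
  [/\ is_fuzzy mu,
      forall p q, Num.min (mu p) (mu q) <= mu (p + q)
    & forall p q, mu p <= mu (p * q)%g]].

Definition fuzzy_ideal := fuzzy_left_ideal `&` fuzzy_right_ideal.

End FuzzyIdealsSemiring.

Arguments gfuzzy_left_ideal K {Gamma} S.
Arguments gfuzzy_right_ideal K {Gamma} S.
Arguments gfuzzy_ideal K {Gamma} S.
Arguments fuzzy_left_ideal K R : clear implicits.
Arguments fuzzy_right_ideal K R : clear implicits.
Arguments fuzzy_ideal K R : clear implicits.

Definition fuzzy_star (K : realType) (Gamma : addSemigroupType)
    (S : gammaSemiringType Gamma) (sigma : S -> K) : rightOp S -> K :=
  fun p => inf [set sigma (ract a p) | a in [set: S]].

Lemma fuzzy_star_pi (K : realType) (Gamma : addSemigroupType)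
    (S : gammaSemiringType Gamma) (sigma : S -> K)
    (g : freeSg (Gamma * S)%type) :
  fuzzy_star sigma (\pi g) =
    inf [set sigma (nsum (fun u => gmul a u.1 u.2) g) | a in [set: S]].
Proof.
by congr inf; apply: eq_imagel => a _; rewrite ract_pi.
Qed.

(* Main.v *)
Require Import Defs.
From HB Require Import structures.
From mathcomp Require Import all_boot all_order all_algebra.
From mathcomp Require Import boolp classical_sets functions reals.

Set Implicit Arguments.
Unset Strict Implicit.
Unset Printing Implicit Defensive.

Import Order.TTheory GRing.Theory Num.Theory.

Local Open Scope quotient_scope.
Local Open Scope classical_set_scope.
Local Open Scope ring_scope.

(** The inverse of [sigma |-> sigma^{*'}] is [mu |-> mu^+], where [mu^+ b] is
    the infimum of [mu [alpha, b]] over [alpha].  Unfolding,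
    [(sigma^{*'})^+ b] is the infimum of [sigma (a alpha b)] over [a, alpha]:
    it is at least [sigma b] because [sigma] is a left ideal, and at most
    [sigma b] because the left unity writes [b] as a sum of terms
    [e_i delta_i b].  Dually, [(mu^+)^{*'} p] is the infimum of
    [mu ([alpha, a] p)], and the right unity writes [p] as a sum of terms
    [[gamma_j, f_j] p]. *)

Section FuzzyInf.
Variables (K : realType) (T : Type) (f : T -> K).
Hypothesis f_fuzzy : is_fuzzy f.

Lemma fuzzy_inf_le t : inf [set f a | a in [set: T]] <= f t.
Proof.
apply: ge_inf; last by exists t.
(* [ge_inf] asks for a lower bound of the image; fuzziness provides 0. *)
by exists 0 => _ [a _ <-]; case/andP: (f_fuzzy a).
Qed.

(** The infimum of the empty set is 0 by convention, so an inhabited index type is required. It will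
    be [S] or [Gamma]. *)
Lemma le_fuzzy_inf (c : K) :
  inhabited T -> (forall t, c <= f t) -> c <= inf [set f a | a in [set: T]].
Proof.
move=> [t0] cf; apply: lb_le_inf; first by exists (f t0), t0.
by move=> _ [a _ <-].
Qed.

Lemma fuzzy_inf01 : inhabited T -> 0 <= inf [set f a | a in [set: T]] <= 1.
Proof.
move=> T0; apply/andP; split.
  by apply: le_fuzzy_inf => // t; case/andP: (f_fuzzy t).
by case: T0 => t; apply: le_trans (fuzzy_inf_le t) _; case/andP: (f_fuzzy t).
Qed.

End FuzzyInf.

(** By [muD] the level set of [mu] at [c] is closed under addition, hence under nonempty finite
    sums. *)
Lemma le_nsum {K : realType} {T : choiceType} {V : addSemigroupType}
    (mu : V -> K) (muD : forall a b, Num.min (mu a) (mu b) <= mu (a + b))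
    (c : K) (F : T -> V) (g : freeSg T) :
  (forall x, c <= mu (F x)) -> c <= mu (nsum F g).
Proof.
move=> cF; elim/freeSg_ind: g => [x|g h IHg IHh]; first by rewrite nsum_gen.
by rewrite nsumD; apply: le_trans (muD _ _); rewrite le_min IHg IHh.
Qed.

Section Correspondence.
Variables (K : realType) (Gamma : addSemigroupType).
Variable S : gammaSemiringType Gamma.

Definition rgen (x : Gamma) (a : S) : rightOp S :=
  \pi_(rightOp S) (fgen (x, a)).

Lemma ract_rgen a x b : ract a (rgen x b) = gmul a x b.
Proof. by rewrite ract_pi /formal_act nsum_gen. Qed.

Lemma ract_gmul a x b (p : rightOp S) :
  ract (gmul a x b) p = gmul a x (ract b p).
Proof. exact: formal_act_gmul. Qed.

Lemma rgenD x a b : rgen x (a + b) = rgen x a + rgen x b.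
Proof. by apply: ract_inj => c; rewrite ractD !ract_rgen gmulDr. Qed.

(** [R] acts faithfully on [S], so both sides are compared on each [c]. This identity converts
    products in [R] into the action on [S], and so links [mu] to [fuzzy_plus mu]. *)
Lemma rgenM x a (p : rightOp S) : (rgen x a * p)%g = rgen x (ract a p).
Proof. by apply: ract_inj => c; rewrite ractM !ract_rgen ract_gmul. Qed.

Lemma rgen_gmul x a y b : rgen x (gmul a y b) = (rgen x a * rgen y b)%g.
Proof. by rewrite rgenM ract_rgen. Qed.

(** Each element of [R] is a sum of generators, and multiplying by [p] on the right distributes over
    it. The case of interest is [g] representing the right unity. *)
Lemma le_pi_mul (mu : rightOp S -> K)
    (muD : forall p q, Num.min (mu p) (mu q) <= mu (p + q))
    (c : K) (g : freeSg (Gamma * S)%type) (p : rightOp S) :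
  (forall x a, c <= mu (rgen x a * p)%g) -> c <= mu (\pi_(rightOp S) g * p)%g.
Proof.
move=> cmu; elim/freeSg_ind: g => [[x a]|g h IHg IHh]; first exact: cmu.
have -> : \pi_(rightOp S) (g + h) = \pi_(rightOp S) g + \pi_(rightOp S) h.
  exact: pi_rightOp_add.
by rewrite mulsDl; apply: le_trans (muD _ _); rewrite le_min IHg IHh.
Qed.

(** Since [R] acts on the right, [a (e p) = (a e) p = a p]: a right unity of [S] is a left identity
    of [R]. *)
Lemma right_unity_mul1 (e : rightOp S) :
  (forall a : S, ract a e = a) -> forall p : rightOp S, (e * p)%g = p.
Proof. by move=> ae p; apply: ract_inj => a; rewrite ractM ae. Qed.

Section Star.
Variable sigma : S -> K.
Hypothesis sigma_fuzzy : is_fuzzy sigma.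

Lemma fuzzy_star_le p a : fuzzy_star sigma p <= sigma (ract a p).
Proof. by apply: (@fuzzy_inf_le K S (fun a => sigma (ract a p))) => b. Qed.

Lemma le_fuzzy_star c p :
  (forall a, c <= sigma (ract a p)) -> c <= fuzzy_star sigma p.
Proof. exact: le_fuzzy_inf inhabited_gsemiring. Qed.

Lemma fuzzy_star_fuzzy : is_fuzzy (fuzzy_star sigma).
Proof.
move=> p; apply: (@fuzzy_inf01 K S (fun a => sigma (ract a p))).
  by move=> a.
exact: inhabited_gsemiring.
Qed.

Lemma fuzzy_starD :
  (forall a b, Num.min (sigma a) (sigma b) <= sigma (a + b)) ->
  forall p q, Num.min (fuzzy_star sigma p) (fuzzy_star sigma q)
              <= fuzzy_star sigma (p + q).
Proof.
move=> sD p q; apply: le_fuzzy_star => a; rewrite ractD.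
by apply: le_trans (sD _ _); rewrite le_min !ge_min !fuzzy_star_le orbT.
Qed.

End Star.

Lemma fuzzy_star_homo (sigma tau : S -> K) :
  is_fuzzy sigma -> (sigma <= tau)%O -> (fuzzy_star sigma <= fuzzy_star tau)%O.
Proof.
move=> fs /lefP st; apply/lefP => p; apply: le_fuzzy_star => a.
exact: le_trans (fuzzy_star_le fs p a) (st _).
Qed.

Lemma fuzzy_star_left (sigma : S -> K) :
  gfuzzy_left_ideal K S sigma ->
  fuzzy_left_ideal K (rightOp S) (fuzzy_star sigma).
Proof.
move=> [fs sD _]; split; [exact: fuzzy_star_fuzzy | exact: fuzzy_starD |].
(* The elements [ract (ract a p) q] are among the [ract b q], so the infimum for [p * q] runs over
   fewer values than the one for [q]. *)
move=> p q; apply: le_fuzzy_star => a; rewrite ractM; exact: fuzzy_star_le.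
Qed.

Lemma fuzzy_star_right (sigma : S -> K) :
  gfuzzy_right_ideal K S sigma ->
  fuzzy_right_ideal K (rightOp S) (fuzzy_star sigma).
Proof.
move=> [fs sD sM]; split; [exact: fuzzy_star_fuzzy | exact: fuzzy_starD |].
move=> p q; apply: le_fuzzy_star => a; rewrite ractM.
apply: le_trans (fuzzy_star_le fs p a) _.
(* [ract (ract a p) q] is a sum of terms [gmul (ract a p) u.1 u.2], each absorbed on the right. *)
by apply: le_nsum => // u; exact: sM.
Qed.

Definition fuzzy_plus (mu : rightOp S -> K) : S -> K :=
  fun b => inf [set mu (rgen x b) | x in [set: Gamma]].

Section Plus.
Variable mu : rightOp S -> K.
Hypothesis mu_fuzzy : is_fuzzy mu.

Lemma fuzzy_plus_le b x : fuzzy_plus mu b <= mu (rgen x b).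
Proof. by apply: (@fuzzy_inf_le K Gamma (fun x => mu (rgen x b))) => y. Qed.

Lemma le_fuzzy_plus c b :
  (forall x, c <= mu (rgen x b)) -> c <= fuzzy_plus mu b.
Proof. exact: le_fuzzy_inf (@inhabited_gamma Gamma S). Qed.

Lemma fuzzy_plus_fuzzy : is_fuzzy (fuzzy_plus mu).
Proof.
move=> b; apply: (@fuzzy_inf01 K Gamma (fun x => mu (rgen x b))).
  by move=> x.
exact: (@inhabited_gamma Gamma S).
Qed.

Lemma fuzzy_plusD :
  (forall p q, Num.min (mu p) (mu q) <= mu (p + q)) ->
  forall a b, Num.min (fuzzy_plus mu a) (fuzzy_plus mu b)
              <= fuzzy_plus mu (a + b).
Proof.
move=> muD a b; apply: le_fuzzy_plus => x; rewrite rgenD.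
by apply: le_trans (muD _ _); rewrite le_min !ge_min !fuzzy_plus_le orbT.
Qed.

End Plus.

Lemma fuzzy_plus_left (mu : rightOp S -> K) :
  fuzzy_left_ideal K (rightOp S) mu -> gfuzzy_left_ideal K S (fuzzy_plus mu).
Proof.
move=> [fm mD mM]; split; [exact: fuzzy_plus_fuzzy | exact: fuzzy_plusD |].
move=> a x b; apply: le_fuzzy_plus => y; rewrite rgen_gmul.
exact: le_trans (fuzzy_plus_le fm b x) (mM _ _).
Qed.

Lemma fuzzy_plus_right (mu : rightOp S -> K) :
  fuzzy_right_ideal K (rightOp S) mu -> gfuzzy_right_ideal K S (fuzzy_plus mu).
Proof.
move=> [fm mD mM]; split; [exact: fuzzy_plus_fuzzy | exact: fuzzy_plusD |].
move=> a x b; apply: le_fuzzy_plus => y; rewrite rgen_gmul.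
exact: le_trans (fuzzy_plus_le fm a y) (mM _ _).
Qed.

Lemma fuzzy_starK (sigma : S -> K) :
  has_left_unity S -> gfuzzy_left_ideal K S sigma ->
  fuzzy_plus (fuzzy_star sigma) = sigma.
Proof.
move=> [e eb] [fs sD sM]; have fss := fuzzy_star_fuzzy fs.
apply/funext => b; apply/eqP; rewrite eq_le; apply/andP; split; last first.
  apply: le_fuzzy_plus => x; apply: le_fuzzy_star => a.
  by rewrite ract_rgen sM.
rewrite -[in leRHS](eb b); apply: le_nsum => // -[a x] /=.
apply: le_trans (fuzzy_plus_le fss b x) _.
(* The term [gmul a x b] is [ract a (rgen x b)], one of the points over which [fuzzy_star] takes its
   infimum. *)
by rewrite -ract_rgen; exact: fuzzy_star_le.
Qed.

Lemma fuzzy_plusK (mu : rightOp S -> K) :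
  has_right_unity S -> fuzzy_left_ideal K (rightOp S) mu ->
  fuzzy_star (fuzzy_plus mu) = mu.
Proof.
move=> [e ae] [fm mD mM]; have fmp := fuzzy_plus_fuzzy fm.
apply/funext => p; apply/eqP; rewrite eq_le; apply/andP; split; last first.
  apply: le_fuzzy_star => a; apply: le_fuzzy_plus => x.
  by rewrite -rgenM mM.
(* Write [p] as [e * p] and expand [e] through a representing formal sum, so that it suffices to
   bound [mu] on each [rgen x a * p]. *)
rewrite -[in leRHS](right_unity_mul1 ae p) -[e]reprK.
apply: le_pi_mul => // x a; rewrite rgenM.
exact: le_trans (fuzzy_star_le fmp p a) (fuzzy_plus_le fm _ x).
Qed.

End Correspondence.

Theorem theorem3p6 (K : realType) (Gamma : addSemigroupType)
    (S : gammaSemiringType Gamma)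
    (hleft : has_left_unity S) (hright : has_right_unity S) :
  (set_bij (gfuzzy_left_ideal K S) (fuzzy_left_ideal K (rightOp S))
     (@fuzzy_star K Gamma S) /\
   {in gfuzzy_left_ideal K S &,
     {homo (@fuzzy_star K Gamma S) : sigma tau / (sigma <= tau)%O}}) /\
  (set_bij (gfuzzy_ideal K S) (fuzzy_ideal K (rightOp S))
     (@fuzzy_star K Gamma S) /\
   {in gfuzzy_ideal K S &,
     {homo (@fuzzy_star K Gamma S) : sigma tau / (sigma <= tau)%O}}).
Proof.
(* Fuzzy ideals are fuzzy left ideals, so this injectivity serves both bijections. *)
have starI (sigma tau : S -> K) : gfuzzy_left_ideal K S sigma ->
    gfuzzy_left_ideal K S tau -> fuzzy_star sigma = fuzzy_star tau -> sigma = tau.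
  by move=> ls lt E; rewrite -(fuzzy_starK hleft ls) E fuzzy_starK.
split; split.
- split.
  + by move=> sigma; exact: fuzzy_star_left.
  + by move=> sigma tau /set_mem ls /set_mem lt; exact: starI.
  + move=> mu lm; exists (fuzzy_plus mu); first exact: fuzzy_plus_left.
    exact: fuzzy_plusK.
- by move=> sigma tau /set_mem[fs _ _] _; exact: fuzzy_star_homo.
- split.
  + move=> sigma [ls rs]; split; first exact: fuzzy_star_left.
    exact: fuzzy_star_right.
  + by move=> sigma tau /set_mem[ls _] /set_mem[lt _]; exact: starI.
  (* The same inverse works, as it also preserves right ideals. *)
  + move=> mu [lm rm]; exists (fuzzy_plus mu); last exact: fuzzy_plusK.
    by split; [exact: fuzzy_plus_left | exact: fuzzy_plus_right].
- by move=> sigma tau /set_mem[[fs _ _] _] _; exact: fuzzy_star_homo.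
Qed.
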